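(* Let $\mathcal{GO}=\langle t,\prec,\phi\rangle$ be a GOMT problem with $\phi$ satisfiable, and let $\langle \mathcal{I},\Delta,\tau\rangle$ be a saturated state occurring in a $\mathcal{GO}$-derivation. Then $\mathcal{I}$ is an optimal solution ($\mathcal{GO}$-solution) of $\mathcal{GO}$.
   Context: Fix a many-sorted first-order theory $\mathcal{T}$ (a signature $\Sigma$ together with a class of $\Sigma$-interpretations, the $\mathcal{T}$-interpretations) with equality, and an infinite set of sorted variables; all interpretations considered are $\mathcal{T}$-interpretations assigning a value to every variable, and $\models$ means $\models_{\mathcal{T}}$ (for formulas $\alpha,\beta$, $\alpha\models\beta$ means every $\mathcal{T}$-interpretation satisfying $\alpha$ satisfies $\beta$). A GOMT (Generalized Optimization Modulo Theories) problem is a triple $\mathcal{GO}=\langle t,\prec,\phi\rangle$ where $t$ is a $\Sigma$-term of some sort $\sigma$, $\prec$ is a strict partial order on the values of sort $\sigma$ that is definable in $\mathcal{T}$, and $\phi$ is a $\Sigma$-formula. An interpretation $\mathcal{I}$ is $\mathcal{GO}$-consistent if $\mathcal{I}\models\phi$; $\mathcal{I}$ $\mathcal{GO}$-dominates $\mathcal{I}'$, written $\mathcal{I}<_{\mathcal{GO}}\mathcal{I}'$, if both are $\mathcal{GO}$-consistent and $t^{\mathcal{I}}\prec t^{\mathcal{I}'}$; $\mathcal{I}$ is an optimal solution ($\mathcal{GO}$-solution) if it is $\mathcal{GO}$-consistent and no interpretation $\mathcal{GO}$-dominates it. $\textsc{Solve}$ is a function mapping a formula to an interpretation satisfying it if it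 is satisfiable, and to a distinguished value $\bot$ otherwise. $\textsc{Better}$ is a function mapping each $\mathcal{GO}$-consistent interpretation $\mathcal{I}$ to a formula $\textsc{Better}(\mathcal{I})$ such that for every $\mathcal{GO}$-consistent $\mathcal{I}'$: $\mathcal{I}'\models\textsc{Better}(\mathcal{I})$ iff $\mathcal{I}'<_{\mathcal{GO}}\mathcal{I}$. For a finite sequence $S=(s_1,\dots,s_n)$, $\textsc{Top}(S)=s_1$, $\textsc{Pop}(S)=(s_2,\dots,s_n)$, $\emptyset$ is the empty sequence and $\circ$ is concatenation. A state is a triple $\langle\mathcal{I},\Delta,\tau\rangle$ with $\mathcal{I}$ an interpretation, $\Delta$ a formula and $\tau$ a finite sequence of formulas. The initial state is $\langle\mathcal{I}_0,\Delta_0,\tau_0\rangle$ with $\mathcal{I}_0=\textsc{Solve}(\phi)$, $\Delta_0=\textsc{Better}(\mathcal{I}_0)$, $\tau_0=(\Delta_0)$. The derivation rules (components not mentioned are unchanged) are: F-Split: if $\tau\neq\emptyset$, $\psi=\textsc{Top}(\tau)$ and $\phi\models\psi\Leftrightarrow\bigvee_{j=1}^k\psi_j$ for some formulas $\psi_1,\dots,\psi_k$, $k\ge1$, then $\tau:=(\psi_1,\dots,\psi_k)\circ\textsc{Pop}(\tau)$. F-Sat: if $\tau\neq\emptyset$, $\psi=\textsc{Top}(\tau)$, $\textsc{Solve}(\phi\wedge\psi)=\mathcal{I}'\neq\bot$ and $\Delta'=\Delta\wedge\textsc{Better}(\mathcal{I}')$, then $\mathcal{I}:=\mathcal{I}'$,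 $\Delta:=\Delta'$, $\tau:=(\Delta')$. F-Close: if $\tau\neq\emptyset$, $\psi=\textsc{Top}(\tau)$ and $\textsc{Solve}(\phi\wedge\psi)=\bot$, then $\Delta:=\Delta\wedge\neg\psi$, $\tau:=\textsc{Pop}(\tau)$. A rule applies to a state if its premises hold and the resulting state is different. A state is saturated if no rule applies to it. A $\mathcal{GO}$-derivation is a (possibly infinite) sequence of states whose first element is the initial state and each subsequent state is obtained from the previous one by applying one of the rules. *)

(* Defs.v *)
From mathcomp Require Import ssreflect ssrfun ssrbool eqtype ssrnat seq.

Set Implicit Arguments.
Unset Strict Implicit.
Unset Printing Implicit Defensive.

Record signature := Signature {
  srt : Type;
  fsym : Type;
  fdom : fsym -> seq srt;
  fcod : fsym -> srt;
  psym : Type;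
  pdom : psym -> seq srt
}.

Record variables (Sg : signature) := Variables {
  var :> eqType;
  vsort : var -> srt Sg;
  var_infinite : forall xs : seq var, exists x, x \notin xs
}.

Fixpoint tup (S : Type) (D : S -> Type) (ss : seq S) : Type :=
  if ss is s :: ss' then (D s * tup D ss')%type else unit.

Section Syntax.

Variables (Sg : signature) (X : variables Sg).

Inductive term : srt Sg -> Type :=
  | Var (x : X) : term (vsort x)
  | App (f : fsym Sg) : terms (fdom f) -> term (fcod f)
with terms : seq (srt Sg) -> Type :=
  | TNil : terms [::]
  | TCons s ss : term s -> terms ss -> terms (s :: ss).

Inductive formula : Type :=
  | Pred (p : psym Sg) (ts : terms (pdom p))
  | Eq (s : srt Sg) (t1 t2 : term s)
  | Neg (f : formula)
  | And (f g : formula)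
  | Or (f g : formula)
  | Imp (f g : formula)
  | Iff (f g : formula)
  | All (x : X) (f : formula)
  | Ex (x : X) (f : formula).

Definition disj (f : formula) (fs : seq formula) : formula := foldl Or f fs.

Fixpoint occurs (x : X) s (t : term s) : bool :=
  match t with
  | Var y => x == y
  | App _ ts => occurs_seq x ts
  end
with occurs_seq (x : X) ss (ts : terms ss) : bool :=
  match ts with
  | TNil => false
  | TCons _ _ t ts' => occurs x t || occurs_seq x ts'
  end.

Fixpoint free (x : X) (f : formula) : bool :=
  match f with
  | Pred _ ts => occurs_seq x ts
  | Eq _ t1 t2 => occurs x t1 || occurs x t2
  | Neg g => free x g
  | And g h | Or g h | Imp g h | Iff g h => free x g || free x h
  | All y g | Ex y g => (x != y) && free x g
  end.

End Syntax.

Arguments Var {Sg X} x.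
Arguments App {Sg X} f _.
Arguments TNil {Sg X}.

(* The domains of a structure are nonempty subsets of a universe U shared by  *)
(* all structures. They may differ from one structure to another, but values  *)
(* of a term in two different interpretations remain comparable, as           *)
(* elements of U.                                                             *)
Record structure (Sg : signature) (U : Type) := Structure {
  dom : srt Sg -> U -> Prop;
  dom_inhabited : forall s, exists u, dom s u;
  fint : forall f : fsym Sg,
    tup (fun s => {u : U | dom s u}) (fdom f) -> {u : U | dom (fcod f) u};
  pint : forall p : psym Sg,
    tup (fun s => {u : U | dom s u}) (pdom p) -> Prop
}.

Section Semantics.

Variables (Sg : signature) (X : variables Sg) (U : Type).

Definition value (M : structure Sg U) (s : srt Sg) : Type := {u : U | dom M s u}.

Definition assignment (M : structure Sg U) : Type :=
  forall x : X, value M (vsort x).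

Fixpoint eval (M : structure Sg U) (a : assignment M) s (t : term X s)
    : value M s :=
  match t in term _ s0 return value M s0 with
  | Var x => a x
  | App f ts => fint (evals a ts)
  end
with evals (M : structure Sg U) (a : assignment M) ss (ts : terms X ss)
    : tup (value M) ss :=
  match ts in terms _ ss0 return tup (value M) ss0 with
  | TNil => tt
  | TCons _ _ t ts' => (eval a t, evals a ts')
  end.

Fixpoint sat (M : structure Sg U) (a : assignment M) (f : formula X) : Prop :=
  match f with
  | Pred p ts => pint (evals a ts)
  | Eq _ t1 t2 => sval (eval a t1) = sval (eval a t2)
  | Neg g => ~ sat a g
  | And g h => sat a g /\ sat a h
  | Or g h => sat a g \/ sat a h
  | Imp g h => sat a g -> sat a h
  | Iff g h => sat a g <-> sat a h
  | All x g => forall v : value M (vsort x), sat (dfwith a v) g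
  | Ex x g => exists v : value M (vsort x), sat (dfwith a v) g
  end.

Record interp := Interp {
  str : structure Sg U;
  asg : assignment str
}.

Definition theory := interp -> Prop.

Definition models (I : interp) (f : formula X) : Prop := sat (asg I) f.

Definition tval (I : interp) s (t : term X s) : U := sval (eval (asg I) t).

Definition satisfiable (T : theory) (f : formula X) : Prop :=
  exists I, T I /\ models I f.

Definition entails (T : theory) (f g : formula X) : Prop :=
  forall I, T I -> models I f -> models I g.

Definition is_value (T : theory) (s : srt Sg) (u : U) : Prop :=
  exists2 I, T I & dom (str I) s u.

Definition strict_order_on (A : U -> Prop) (R : U -> U -> Prop) : Prop :=
  (forall u, A u -> ~ R u u) /\
  (forall u v w, A u -> A v -> A w -> R u v -> R v w -> R u w).

(* The assignment b ranges over all assignments into the structure of I, so   *)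
(* that (x, y) takes all pairs of elements of its domain of sort s, whether   *)
(* or not T is closed under reassignment of variables.                        *)
Definition definable (T : theory) (s : srt Sg) (R : U -> U -> Prop) : Prop :=
  exists (x y : X) (f : formula X),
    [/\ x != y, vsort x = s, vsort y = s,
        (forall z, free z f -> z = x \/ z = y)
      & forall I, T I -> forall b : assignment (str I),
          sat b f <-> R (sval (b x)) (sval (b y))].

End Semantics.

Section GOMT.

Variables (Sg : signature) (X : variables Sg) (U : Type) (T : theory X U).

Record gomt := Gomt {
  osort : srt Sg;
  objective : term X osort;
  prec : U -> U -> Prop;
  prec_strict : strict_order_on (is_value T osort) prec;
  prec_definable : definable T osort prec;
  constraint : formula X
}.

Variable GO : gomt.

Definition consistent (I : interp X U) : Prop :=
  T I /\ models I (constraint GO).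

Definition dominates (I I' : interp X U) : Prop :=
  [/\ consistent I, consistent I'
    & prec GO (tval I (objective GO)) (tval I' (objective GO))].

Definition solution (I : interp X U) : Prop :=
  consistent I /\ forall I', T I' -> ~ dominates I' I.

(* None stands for the distinguished value returned on unsatisfiable input. *)
Definition is_solve (Solve : formula X -> option (interp X U)) : Prop :=
  forall f,
    (satisfiable T f -> exists I, [/\ Solve f = Some I, T I & models I f]) /\
    (~ satisfiable T f -> Solve f = None).

(* Better is total; its values outside consistent interpretations are free. *)
Definition is_better (Better : interp X U -> formula X) : Prop :=
  forall I, consistent I ->
  forall I', consistent I' -> (models I' (Better I) <-> dominates I' I).

Record state := State {
  st_interp : interp X U;
  st_delta : formula X;
  st_tau : seq (formula X)
}.

Variables (Solve : formula X -> option (interp X U))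
          (Better : interp X U -> formula X).

Definition initial (st : state) : Prop :=
  exists2 I0, Solve (constraint GO) = Some I0 &
    st = State I0 (Better I0) [:: Better I0].

Inductive rule : state -> state -> Prop :=
  | F_Split I D psi tau psi1 psis :
      entails T (constraint GO) (Iff psi (disj psi1 psis)) ->
      rule (State I D (psi :: tau)) (State I D ((psi1 :: psis) ++ tau))
  | F_Sat I D psi tau I' :
      Solve (And (constraint GO) psi) = Some I' ->
      rule (State I D (psi :: tau))
           (State I' (And D (Better I')) [:: And D (Better I')])
  | F_Close I D psi tau :
      Solve (And (constraint GO) psi) = None ->
      rule (State I D (psi :: tau)) (State I (And D (Neg psi)) tau).

Definition step (st st' : state) : Prop := rule st st' /\ st' <> st.

Definition saturated (st : state) : Prop := forall st', ~ step st st'.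

(* A finite derivation of length n is None from index n on. *)
Definition derivation (d : nat -> option state) : Prop :=
  (exists2 st, d 0 = Some st & initial st) /\
  (forall n st', d n.+1 = Some st' ->
     exists2 st, d n = Some st & step st st').

End GOMT.

(* Main.v *)
Require Import Defs.
From mathcomp Require Import ssreflect ssrfun ssrbool eqtype ssrnat seq.
From Stdlib Require Import Classical.

(** Along a derivation the current interpretation [I] stays consistent, and for
    every consistent [J] the conditions "[J] satisfies Delta", "[J] satisfies
    some member of tau" and "[J] dominates [I]" remain equivalent. In a
    saturated state tau is empty: otherwise F-Close shortens tau or F-Sat
    replaces [I] by an interpretation that dominates it, which differs from [I]
    by irreflexivity. With tau empty nothing dominates [I]. *)

Set Implicit Arguments.
Unset Strict Implicit.
Unset Printing Implicit Defensive.

Section Correctness.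

Variables (Sg : signature) (X : variables Sg) (U : Type).
Implicit Types (I J : interp X U) (f : formula X) (fs : seq (formula X)).

(** Kept semantic because [disj] needs a first disjunct, while an empty tau must count as false. *)
Fixpoint models_some J fs : Prop :=
  if fs is f :: fs' then models J f \/ models_some J fs' else False.

Lemma models_some_cat J fs gs :
  models_some J (fs ++ gs) <-> models_some J fs \/ models_some J gs.
Proof. by elim: fs => [|f fs IH] /=; tauto. Qed.

Lemma models_disj J f fs : models J (disj f fs) <-> models_some J (f :: fs).
Proof.
(* [disj] is a left fold, so its accumulator [f] is generalized. *)
elim: fs f => [|g fs IH] f /=; first by tauto.
by have := IH (Or f g); rewrite /= {2}/models /= -!/(models _ _); tauto.
Qed.

Variables (T : theory X U) (GO : gomt T).

(** Discharges the side conditions of the order laws, which are relativized to values of the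
    sort. *)
Lemma tval_is_value I s (t : term X s) : T I -> is_value T s (tval I t).
Proof. by move=> TI; exists I => //; exact: (proj2_sig (eval _ t)). Qed.

Lemma dominates_irrefl I : ~ dominates GO I I.
Proof.
case=> -[TI _] _; case: (prec_strict GO) => irr _.
exact: irr (tval_is_value _ TI).
Qed.

Lemma dominates_trans I J K :
  dominates GO I J -> dominates GO J K -> dominates GO I K.
Proof.
move=> [cI cJ IJ] [_ cK JK]; split=> //.
case: (prec_strict GO) => _ tr.
by apply: tr IJ JK; apply: tval_is_value; [case: cI | case: cJ | case: cK].
Qed.

Variables (Solve : formula X -> option (interp X U))
          (Better : interp X U -> formula X).
Hypotheses (solveP : is_solve T Solve) (betterP : is_better GO Better).

(** [is_solve] splits on satisfiability, so excluded middle picks the case. *)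
Lemma solve_Some f I : Solve f = Some I -> T I /\ models I f.
Proof.
move=> fI; case: (solveP f) => sf uf.
case: (classic (satisfiable T f)) => [/sf|/uf]; last by rewrite fI.
by rewrite fI => -[J [[->]]].
Qed.

Lemma solve_None f I : Solve f = None -> T I -> ~ models I f.
Proof.
move=> fN TI fI; case: (solveP f) => sf _.
by case: (sf (ex_intro _ I (conj TI fI))) => J []; rewrite fN.
Qed.

(** Only consistent [J] are tested: the specification of [Better] and the premise of F-Split are
    silent elsewhere. *)
Definition invariant (st : state X U) : Prop :=
  consistent GO (st_interp st) /\
  forall J, consistent GO J ->
    (models J (st_delta st) <-> dominates GO J (st_interp st)) /\
    (models J (st_delta st) <-> models_some J (st_tau st)).

Lemma invariant_initial st : initial GO Solve Better st -> invariant st.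
Proof.
case=> I /solve_Some cI ->; split=> // J cJ /=.
by have := betterP cI cJ; tauto.
Qed.

(** Serves twice: F-Sat preserves the invariant, and F-Sat really changes the state. *)
Lemma invariant_sat_dominates I D psi tau J :
  invariant (State I D (psi :: tau)) ->
  Solve (And (constraint GO) psi) = Some J -> dominates GO J I.
Proof.
case=> _ inv /solve_Some [TJ [phiJ psiJ]].
have [/= H1 H2] := inv J (conj TJ phiJ).
by apply/H1/H2; left.
Qed.

Lemma invariant_rule st st' :
  rule GO Solve Better st st' -> invariant st -> invariant st'.
Proof.
case=> [I D psi tau psi1 psis split_psi|I D psi tau I' sol|I D psi tau sol] inv.
- case: inv => cI inv; split=> // J cJ; have [/= H1 H2] := inv J cJ.
  have [TJ phiJ] := cJ; have psiE : _ <-> _ := split_psi J TJ phiJ.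
  have dE := models_disj J psi1 psis.
  have cE := models_some_cat J (psi1 :: psis) tau.
  by rewrite -!/(models _ _) /= in psiE dE cE *; tauto.
(* The new Delta says that [J] dominates both [I] and [I']; by transitivity the latter suffices. The
   new tau is just this Delta. *)
- have I'I := invariant_sat_dominates inv sol.
  case: inv => cI inv; have cI' : consistent GO I' by case: I'I.
  split=> // J cJ; have [/= H1 _] := inv J cJ; have B := betterP cI' cJ.
  have tr : dominates GO J I' -> dominates GO J I.
    by move=> JI'; apply: dominates_trans I'I.
  by rewrite {1 2 3}/models /= -!/(models _ _); tauto.
(* No consistent [J] satisfies [psi], so neither adding [Neg psi] nor dropping [psi] affects it. *)
- case: inv => cI inv; split=> // J cJ; have [/= H1 H2] := inv J cJ.
  have [TJ phiJ] := cJ; have npsi : ~ models J psi.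
    by move=> psiJ; apply: (solve_None sol TJ); split.
  by rewrite {1 2}/models /= -!/(models _ _); tauto.
Qed.

Lemma invariant_derivation d n st :
  derivation GO Solve Better d -> d n = Some st -> invariant st.
Proof.
case=> -[st0 d0 init] dS; elim: n st => [|n IH] st.
  by rewrite d0 => -[<-]; exact: invariant_initial.
by case/dS=> st1 /IH inv1 [r _]; exact: invariant_rule r inv1.
Qed.

Lemma saturated_tau_nil st :
  invariant st -> saturated GO Solve Better st -> st_tau st = [::].
Proof.
case: st => I D [//|psi tau] inv stuck; exfalso.
case sol: (Solve (And (constraint GO) psi)) => [J|].
  apply: (stuck _ (conj (F_Sat Better I D tau sol) _)) => -[JI _ _].
  have := invariant_sat_dominates inv sol.
  by rewrite JI => /dominates_irrefl.
apply: (stuck _ (conj (F_Close Better I D tau sol) _)) => -[_].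
(* An unchanged state would equate [tau] with the longer [psi :: tau]. *)
by move/(congr1 size)/eqP; rewrite /= ltn_eqF.
Qed.

End Correctness.

Unset Implicit Arguments.

Theorem theorem1 (Sg : signature) (X : variables Sg) (U : Type)
    (T : theory X U) (GO : gomt T)
    (Solve : formula X -> option (interp X U))
    (Better : interp X U -> formula X)
    (solveP : is_solve T Solve) (betterP : is_better GO Better)
    (phi_sat : satisfiable T (constraint GO))
    (d : nat -> option (state X U)) (d_deriv : derivation GO Solve Better d)
    (n : nat) (st : state X U) (st_in_d : d n = Some st)
    (st_saturated : saturated GO Solve Better st) :
  solution GO (st_interp st).
Proof.
have inv := invariant_derivation solveP betterP d_deriv st_in_d.
have tau0 := saturated_tau_nil solveP inv st_saturated.
case: inv => cI inv; split=> // J _ dJ.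
have cJ : consistent GO J by case: dJ.
have [deltaE tauE] := inv J cJ.
by move/deltaE/tauE: dJ; rewrite tau0.
Qed.
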